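(* Let $\alpha,\beta,\gamma,\delta\in\mathbb{R}$ with $\alpha+\delta\neq 0$ and $\alpha\gamma-\beta\delta=0$, and let $(G_6,g,J)$ be the connected, simply connected three-dimensional Lorentzian Lie group with product structure $J$ whose Lie algebra $\mathfrak{g}$ has a pseudo-orthonormal basis $\{e_1,e_2,e_3\}$ ($e_3$ timelike) with $[e_1,e_2]=\alpha e_2+\beta e_3$, $[e_1,e_3]=\gamma e_2+\delta e_3$, $[e_2,e_3]=0$. Let $c\in\mathbb{R}$. Then $(G_6,g,J)$ is a first kind algebraic Ricci soliton associated to the canonical connection $\nabla^0$ with constant $c$ if and only if one of the following holds: (i) $\alpha=\beta=\gamma=c=0$, $\delta\neq 0$; in particular, $D=0$; (ii) $\alpha\neq 0$, $\beta=\gamma=0$, $\alpha^2+c=0$, $\alpha+\delta\neq 0$; in particular, $De_1=0$, $De_2=0$, $De_3=\alpha^2e_3$; (iii) $\alpha\neq 0$, $\beta\neq 0$, $\gamma=\delta=0$, $\beta^2=2\alpha^2$, $c=0$; in particular, $D=0$.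
   Context: The left-invariant Lorentzian metric $g$ satisfies $g(e_1,e_1)=g(e_2,e_2)=1$, $g(e_3,e_3)=-1$, $g(e_i,e_j)=0$ for $i\ne j$. All tensors and connections are left-invariant and evaluated on $\mathfrak{g}$. $\nabla$ is the Levi-Civita connection of $g$. The product structure is $Je_1=e_1$, $Je_2=e_2$, $Je_3=-e_3$, and $(\nabla_XJ)Y=\nabla_X(JY)-J(\nabla_XY)$. The canonical connection is $\nabla^0_XY=\nabla_XY-\frac12(\nabla_XJ)(JY)$, with curvature $R^0(X,Y)Z=\nabla^0_X\nabla^0_YZ-\nabla^0_Y\nabla^0_XZ-\nabla^0_{[X,Y]}Z$. Its Ricci tensor is $\rho^0(X,Y)=-g(R^0(X,e_1)Y,e_1)-g(R^0(X,e_2)Y,e_2)+g(R^0(X,e_3)Y,e_3)$ and the Ricci operator $\mathrm{Ric}^0$ is defined by $\rho^0(X,Y)=g(\mathrm{Ric}^0(X),Y)$. First kind algebraic Ricci soliton associated to $\nabla^0$ with constant $c$ means: $\mathrm{Ric}^0=c\,\mathrm{Id}+D$ where $D$ is a derivation of $\mathfrak{g}$, i.e. a linear map with $D[X,Y]=[DX,Y]+[X,DY]$ for all $X,Y\in\mathfrak{g}$. *)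

(* Defs.v *)
From HB Require Import structures.
From mathcomp Require Import all_boot all_order all_algebra.
From mathcomp Require Import sesquilinear reals.

Set Implicit Arguments.
Unset Strict Implicit.
Unset Printing Implicit Defensive.

Import GRing.Theory Num.Theory.

Local Open Scope ring_scope.

(* Left-invariant geometry of a Lie group, on its Lie algebra [V].
   Left-invariant vector fields are the vectors of [V]; a left-invariant
   connection is a map [V -> V -> V], with [conn X Y] standing for the
   covariant derivative of [Y] in the direction [X]. *)
Section LeftInvariantGeometry.
Variables (R : realType) (V : vectType R).

Implicit Types (br nabla : {bilinear V -> V -> V}) (g : {symmetric V}).
Implicit Types (conn : V -> V -> V) (J D : 'End(V)) (e X Y Z : V).

Definition is_lie_bracket br : Prop :=
  (forall X, br X X = 0) /\
  (forall X Y Z, br X (br Y Z) + br Y (br Z X) + br Z (br X Y) = 0).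

Definition is_derivation br D : Prop :=
  forall X Y, D (br X Y) = br (D X) Y + br X (D Y).

Definition pseudo_orthonormal_basis g e1 e2 e3 : Prop :=
  [/\ basis_of fullv [:: e1; e2; e3],
      [/\ g e1 e1 = 1, g e2 e2 = 1 & g e3 e3 = -1] &
      [/\ g e1 e2 = 0, g e1 e3 = 0 & g e2 e3 = 0]].

Definition product_structure J e1 e2 e3 : Prop :=
  [/\ J e1 = e1, J e2 = e2 & J e3 = - e3].

(* The usual metric condition X (g(Y,Z)) = g(nabla_X Y,Z) + g(Y,nabla_X Z) has
   zero left-hand side, since g(Y,Z) is constant for left-invariant Y and Z. *)
Definition is_levi_civita br g nabla : Prop :=
  (forall X Y, nabla X Y - nabla Y X = br X Y) /\
  (forall X Y Z, g (nabla X Y) Z + g Y (nabla X Z) = 0).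

Definition covariant_derivative conn J X Y : V :=
  conn X (J Y) - J (conn X Y).

Definition canonical_connection conn J X Y : V :=
  conn X Y - 2^-1 *: covariant_derivative conn J X (J Y).

Definition curvature br conn X Y Z : V :=
  conn X (conn Y Z) - conn Y (conn X Z) - conn (br X Y) Z.

Definition ricci_tensor br g conn e1 e2 e3 X Y : R :=
  - g (curvature br conn X e1 Y) e1 - g (curvature br conn X e2 Y) e2
  + g (curvature br conn X e3 Y) e3.

Definition is_ricci_operator br g conn e1 e2 e3 (Ric : 'End(V)) : Prop :=
  forall X Y, ricci_tensor br g conn e1 e2 e3 X Y = g (Ric X) Y.

Definition soliton_with_derivation br g conn e1 e2 e3 (c : R) D : Prop :=
  exists Ric : 'End(V),
    [/\ is_ricci_operator br g conn e1 e2 e3 Ric,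
        is_derivation br D &
        Ric = c *: \1%VF + D].

Definition first_kind_soliton br g conn e1 e2 e3 (c : R) : Prop :=
  exists D : 'End(V), soliton_with_derivation br g conn e1 e2 e3 c D.

End LeftInvariantGeometry.

(* Main.v *)
(* The canonical connection makes the eigenspaces [span(e1,e2)] and [span(e3)]
   of [J] parallel, so it is determined by one linear form
   [w X = g(nabla_X e1, e2)], and its curvature is [- w [X,Y]] times the
   infinitesimal rotation of the [(e1,e2)]-plane.  With [A = w [e1,e2]] and
   [B = w [e1,e3]] the Ricci operator is [e1 |-> A e1], [e2 |-> A e2],
   [e3 |-> B e2]; the derivation property of [Ric - c Id] then amounts to four
   polynomial equations which, as [alpha + delta <> 0], force [A = c]. *)
Require Import Defs.
From HB Require Import structures.
From mathcomp Require Import all_boot all_order all_algebra.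
From mathcomp Require Import sesquilinear reals.
From mathcomp Require Import ring lra.

Set Implicit Arguments.
Unset Strict Implicit.
Unset Printing Implicit Defensive.

Import GRing.Theory Num.Theory.

Local Open Scope ring_scope.

(** * Reduction of linear identities to basis vectors *)

Lemma basis_ind (K : fieldType) (V : vectType K) (s : seq V) (P : V -> Prop) :
    basis_of fullv s -> P 0 ->
    (forall a u v, P u -> P v -> P (a *: u + v)) ->
    (forall u, u \in s -> P u) ->
  forall v, P v.
Proof.
move=> sV P0 PZD Ps v.
rewrite (@coord_basis _ _ _ _ (in_tuple s) _ sV (memvf v)).
elim/big_ind: _ => // [x y Px Py|i _]; first by rewrite -[x]scale1r; apply: PZD.
rewrite -[_ *: _]addr0; apply: PZD => //; apply: Ps.
by rewrite mem_nth //= size_tuple.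
Qed.

Lemma derivation_of_basis (R : realType) (V : vectType R)
    (br : {bilinear V -> V -> V}) (D : 'End(V)) (s : seq V) :
    basis_of fullv s ->
    {in s &, forall u v, D (br u v) = br (D u) v + br u (D v)} ->
  is_derivation br D.
Proof.
move=> sV Ds X Y; move: X; apply: (basis_ind sV).
- by rewrite !(linear0, linear0l) addr0.
- move=> a u v Pu Pv.
  by rewrite !(linearDl, linearZl_LR, linearP) /= Pu Pv scalerDr addrACA.
move=> u us; move: Y; apply: (basis_ind sV).
- by rewrite !(linear0, linear0r) addr0.
- move=> a v w Pv Pw.
  by rewrite !(linearDr, linearZr_LR, linearP) /= Pv Pw scalerDr addrACA.
by move=> v vs; apply: Ds.
Qed.

Lemma alternating_anti (R : realType) (V : vectType R)
    (br : {bilinear V -> V -> V}) :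
  (forall X, br X X = 0) -> forall X Y, br Y X = - br X Y.
Proof.
move=> br0 X Y; apply/eqP; rewrite -addr_eq0; apply/eqP.
by rewrite -[RHS](br0 (X + Y)) linearDl /= !linearDr /= !br0 addr0 add0r addrC.
Qed.

(** * Symmetric forms, the Koszul formula and pseudo-orthonormal frames *)

Section SymmetricForm.
Variables (R : realType) (V : vectType R) (g : {symmetric V}).

Lemma formC u v : g u v = g v u.
Proof. by rewrite hermC expr0 mul1r. Qed.

(** A signed sum of the metric condition over the cyclic permutations of [X], [Y], [Z], with
    differences of [nabla] turned into brackets by vanishing torsion. The usual derivative terms are
    absent because [g] is constant on left-invariant fields. *)
Lemma koszul (br nabla : {bilinear V -> V -> V}) : is_levi_civita br g nabla ->
  forall X Y Z,
  2 * g (nabla X Y) Z = g (br X Y) Z - g (br Y Z) X + g (br Z X) Y.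
Proof.
move=> [tors met] X Y Z.
have := met X Y Z; have := met Y Z X; have := met Z X Y.
rewrite -!tors !linearBl /= (formC X) (formC Y) (formC Z).
lra.
Qed.

Variables e1 e2 e3 : V.
Hypothesis h_basis : pseudo_orthonormal_basis g e1 e2 e3.

Lemma basis_frame : basis_of fullv [:: e1; e2; e3].
Proof. by case: h_basis. Qed.

Lemma gram : (((g e1 e1 = 1) * (g e2 e2 = 1) * (g e3 e3 = -1)) *
  ((g e1 e2 = 0) * (g e1 e3 = 0) * (g e2 e3 = 0)) *
  ((g e2 e1 = 0) * (g e3 e1 = 0) * (g e3 e2 = 0)))%type.
Proof.
case: h_basis => _ [? ? ?] [? ? ?].
by rewrite (formC e2 e1) (formC e3 e1) (formC e3 e2).
Qed.

(** The minus sign reflects that [e3] is timelike. *)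
Lemma frame_expansion v : v = g v e1 *: e1 + g v e2 *: e2 - g v e3 *: e3.
Proof.
move: v; apply: (basis_ind basis_frame).
- by rewrite !linear0l !scale0r oppr0 !addr0.
- move=> a u v Hu Hv; rewrite {1}Hu {1}Hv !linearDl !linearZl_LR /=.
  by rewrite !scalerDl !scalerDr scalerN !scalerA opprD addrACA; congr (_ + _);
     rewrite addrACA.
move=> u; rewrite !inE => /or3P[] /eqP->; rewrite !gram;
  by rewrite !(scale1r, scale0r, scaleN1r, opprK, oppr0, addr0, add0r).
Qed.

Lemma frame_eq u v :
  g u e1 = g v e1 -> g u e2 = g v e2 -> g u e3 = g v e3 -> u = v.
Proof.
by move=> h1 h2 h3; rewrite (frame_expansion u) h1 h2 h3 -frame_expansion.
Qed.

Lemma form_nondegenerate u v : (forall w, g u w = g v w) -> u = v.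
Proof. by move=> uv; apply: frame_eq. Qed.

Lemma End_frame_eq (f h : 'End(V)) :
  f e1 = h e1 -> f e2 = h e2 -> f e3 = h e3 -> f = h.
Proof.
move=> h1 h2 h3; apply/lfunP => v.
by rewrite (frame_expansion v) !linearB !linearD !linearZ /= h1 h2 h3.
Qed.

Lemma End_frame_exists u1 u2 u3 :
  exists f : 'End(V), [/\ f e1 = u1, f e2 = u2 & f e3 = u3].
Proof.
have [f fP] := linear_of_free [:: e1; e2; e3] [:: u1; u2; u3].
have [] := fP (basis_free basis_frame) erefl => f1 f2 f3.
by exists (linfun f); rewrite !lfunE.
Qed.

(** * The canonical connection, its curvature and its Ricci operator *)

Variables (br nabla : {bilinear V -> V -> V}) (J : 'End(V)).
Hypothesis h_J : product_structure J e1 e2 e3.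
Hypothesis h_nabla : is_levi_civita br g nabla.

Let nabla0 := canonical_connection nabla J.
Let w X := g (nabla X e1) e2.

Lemma form_product_structure u v : g (J u) v = g u (J v).
Proof.
case: h_J => J1 J2 J3.
rewrite (frame_expansion u) (frame_expansion v).
rewrite !(linearB, linearD, linearZ) /= J1 J2 J3.
rewrite !(linearBl, linearBr, linearDl, linearDr, linearNl, linearNr,
  linearZl_LR, linearZr_LR) /= !gram /=.
ring.
Qed.

(** As [J] is an involution, [nabla0 X Y] is the average of [nabla X Y] and [J (nabla X (J Y))].
    Averaging kills the components mixing [e3] with the [(e1,e2)]-plane. Of the skew operator
    [nabla X] there remains only its rotation part in that plane. *)
Lemma canonical_connectionE X Y :
  nabla0 X Y = w X *: (g Y e1 *: e2 - g Y e2 *: e1).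
Proof.
have [J1 J2 J3] := h_J; have [_ met] := h_nabla.
move: Y; apply: (basis_ind basis_frame).
- rewrite /nabla0 /canonical_connection /covariant_derivative.
  by rewrite !(linear0, linear0l, linear0r, subr0, scale0r, scaler0).
- move=> a u v Hu Hv.
  have -> : nabla0 X (a *: u + v) = a *: nabla0 X u + nabla0 X v.
    rewrite /nabla0 /canonical_connection /covariant_derivative.
    apply: frame_eq; rewrite !(linearP, linearPr) /=;
    rewrite !(linearBl, linearDl, linearNl, linearZl_LR) /=; ring.
  rewrite Hu Hv; apply: frame_eq;
  rewrite !(linearBl, linearDl, linearNl, linearZl_LR) /= !gram; ring.
(* Metric compatibility makes [nabla X] skew for [g]. *)
have m i j : g (nabla X i) j = - g (nabla X j) i.
  by apply/eqP; rewrite -addr_eq0 (formC (nabla X j)) met.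
have m0 i : g (nabla X i) i = 0 by have := m i i; lra.
move=> u; rewrite !inE => /or3P[] /eqP->;
rewrite /nabla0 /canonical_connection /covariant_derivative;
rewrite ?(J1, J2, J3, linearN) /=;
apply: frame_eq;
rewrite ?(linearBl, linearDl, linearNl, linearZl_LR, linearNr,
  form_product_structure) /= ?(J1, J2, J3, linearN, linearNr, linearNl) /=
  ?form_product_structure ?(J1, J2, J3, linearN, linearNr, linearNl) /=
  !gram ?m0 /w ?(m e2 e1) ?(m e3 e1) ?(m e3 e2); by field.
Qed.

(** All operators [nabla0 X] are multiples of one rotation generator, so they commute and only the
    bracket term survives. *)
Lemma curvature_canonicalE X Y Z :
  curvature br nabla0 X Y Z =
  - w (br X Y) *: (g Z e1 *: e2 - g Z e2 *: e1).
Proof.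
rewrite /curvature !canonical_connectionE; apply: frame_eq;
rewrite !(linearBl, linearDl, linearNl, linearZl_LR) /= !gram; ring.
Qed.

Lemma ricci_canonicalE X Y :
  ricci_tensor br g nabla0 e1 e2 e3 X Y =
  w (br X e2) * g Y e1 - w (br X e1) * g Y e2.
Proof.
rewrite /ricci_tensor !curvature_canonicalE.
rewrite !(linearBl, linearDl, linearNl, linearZl_LR) /= !gram; ring.
Qed.

Lemma ricci_operator_canonicalP (Ric : 'End(V)) :
  is_ricci_operator br g nabla0 e1 e2 e3 Ric <->
  forall X, Ric X = w (br X e2) *: e1 - w (br X e1) *: e2.
Proof.
split=> [RicP X|RicE X Y]; last first.
  rewrite ricci_canonicalE RicE linearBl /= !linearZl_LR /=.
  by rewrite (formC e1) (formC e2).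
apply: form_nondegenerate => Y.
rewrite -RicP ricci_canonicalE linearBl /= !linearZl_LR /=.
by rewrite (formC e1) (formC e2).
Qed.

(** * Soliton and derivation conditions in terms of the structure constants *)

Variables alpha beta gamma delta c : R.
Hypothesis h_br : is_lie_bracket br.
Hypothesis h_br12 : br e1 e2 = alpha *: e2 + beta *: e3.
Hypothesis h_br13 : br e1 e3 = gamma *: e2 + delta *: e3.
Hypothesis h_br23 : br e2 e3 = 0.

Let A := beta * (beta - gamma) / 2 - alpha ^+ 2.
Let B := delta * (beta - gamma) / 2 - alpha * gamma.

Let br_frame : ((br e1 e1 = 0) * (br e2 e2 = 0) * (br e3 e3 = 0) *
  (br e2 e1 = - (alpha *: e2 + beta *: e3)) *
  (br e3 e1 = - (gamma *: e2 + delta *: e3)) *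
  (br e3 e2 = 0))%type.
Proof.
have [br0 _] := h_br; have anti := alternating_anti br0.
by rewrite !br0 (anti e1 e2) (anti e1 e3) (anti e2 e3) h_br12 h_br13 h_br23 oppr0.
Qed.

Lemma connection_form_frame :
  [/\ w e1 = 0, w e2 = - alpha & w e3 = (beta - gamma) / 2].
Proof.
split; rewrite /w;
[have := koszul h_nabla e1 e1 e2|have := koszul h_nabla e2 e1 e2|
 have := koszul h_nabla e3 e1 e2];
rewrite ?(br_frame, h_br12, h_br13, h_br23);
rewrite ?(linear0l, linearNl, linearDl, linearZl_LR) /= !gram; lra.
Qed.

Lemma connection_form_brackets :
  [/\ w (br e1 e1) = 0, w (br e2 e1) = - A & w (br e3 e1) = - B] /\
  [/\ w (br e1 e2) = A, w (br e2 e2) = 0 & w (br e3 e2) = 0].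
Proof.
have [w1 w2 w3] := connection_form_frame.
have wD u v : w (u + v) = w u + w v by rewrite /w linearDl /= linearDl.
have wN u : w (- u) = - w u by rewrite /w linearNl /= linearNl.
have wZ a u : w (a *: u) = a * w u by rewrite /w linearZl_LR /= linearZl_LR.
have w0 : w 0 = 0 by rewrite /w !linear0l.
rewrite !br_frame h_br12 !(w0, wN, wD, wZ) w2 w3 /A /B.
by split; split; ring.
Qed.

(** The soliton equation forces [D] to be the Ricci operator minus [c] times the identity, so its
    values on the frame are prescribed. *)
Lemma soliton_with_derivationP (D : 'End(V)) :
  soliton_with_derivation br g nabla0 e1 e2 e3 c D <->
  [/\ D e1 = (A - c) *: e1, D e2 = (A - c) *: e2, D e3 = B *: e2 - c *: e3
    & is_derivation br D].
Proof.
have [[w11 w21 w31] [w12 w22 w32]] := connection_form_brackets.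
split=> [[Ric [/ricci_operator_canonicalP RicE derD RicD]]|[D1 D2 D3 derD]].
  have DE X : D X = Ric X - c *: X.
    by rewrite RicD add_lfunE scale_lfunE id_lfunE addrC addKr.
  split=> //; rewrite DE RicE ?(w11, w21, w31, w12, w22, w32);
  apply: frame_eq; rewrite !(linearBl, linearZl_LR) /= !gram; ring.
exists (c *: \1%VF + D); split=> //; apply/ricci_operator_canonicalP => X.
rewrite add_lfunE scale_lfunE id_lfunE.
(* Linearity in [X] reduces the Ricci formula to the frame values of [w] on brackets. *)
have brl u : w (br X u) = g X e1 * w (br e1 u) + g X e2 * w (br e2 u)
    - g X e3 * w (br e3 u).
  rewrite {1}(frame_expansion X) /w.
  by rewrite !(linearBl, linearDl, linearZl_LR) /=.
rewrite !brl w11 w21 w31 w12 w22 w32.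
rewrite {1 2}(frame_expansion X) !(linearB, linearD, linearZ) /= D1 D2 D3.
apply: frame_eq; rewrite !(linearBl, linearDl, linearNl, linearZl_LR) /= !gram; ring.
Qed.

(** The first two equations are the [e2] and [e3] components of the derivation identity on
    [(e1,e2)], the last two those on [(e1,e3)]. The pair [(e2,e3)] gives nothing, since [D]
    preserves the abelian plane spanned by [e2] and [e3]. *)
Lemma frame_derivationP (D : 'End(V)) :
    D e1 = (A - c) *: e1 -> D e2 = (A - c) *: e2 ->
    D e3 = B *: e2 - c *: e3 ->
  is_derivation br D <->
  [/\ beta * B = alpha * (A - c), beta * (2 * A - c) = 0,
      (delta - alpha) * B = - (c * gamma) & delta * (A - c) + beta * B = 0].
Proof.
move=> D1 D2 D3.
have e23_inj a b a' b' : a *: e2 + b *: e3 = a' *: e2 + b' *: e3 ->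
    a = a' /\ b = b'.
  move=> eq_ab; have := congr1 (g^~ e2) eq_ab; have := congr1 (g^~ e3) eq_ab.
  by rewrite !(linearDl, linearZl_LR) /= !gram => ? ?; split; lra.
split=> [derD|[E1 E2 E3 E4]].
  have := derD e1 e2; have := derD e1 e3.
  rewrite h_br12 h_br13 !(linearD, linearZ) /= D1 D2 D3.
  rewrite !(linearZl_LR, linearBr, linearZr_LR) /= h_br12 h_br13.
  move=> eq13 eq12.
  have {eq12} [] : alpha * (A - c) + beta * B = 2 * alpha * (A - c) /\
      - beta * c = 2 * beta * (A - c).
    apply: e23_inj; transitivity (alpha *: ((A - c) *: e2) +
      beta *: (B *: e2 - c *: e3)); last rewrite eq12;
    apply: frame_eq; rewrite !(linearBl, linearDl, linearNl, linearZl_LR) /= !gram; ring.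
  have {eq13} [] : gamma * (A - c) + delta * B =
      gamma * (A - c) + B * alpha - c * gamma /\
      - delta * c = delta * (A - c) + B * beta - c * delta.
    apply: e23_inj; transitivity (gamma *: ((A - c) *: e2) +
      delta *: (B *: e2 - c *: e3)); last rewrite eq13;
    apply: frame_eq; rewrite !(linearBl, linearDl, linearNl, linearZl_LR) /= !gram; ring.
  by move=> *; split; lra.
have derP u v : D (br u v) = br (D u) v + br u (D v) ->
    D (br v u) = br (D v) u + br v (D u).
  have [br0 _] := h_br; have anti := alternating_anti br0 => duv.
  by rewrite (anti u v) linearN /= duv (anti u (D v)) (anti (D u) v) opprD addrC.
have der0 u : D (br u u) = br (D u) u + br u (D u).
  have [br0 _] := h_br; have anti := alternating_anti br0.
  by rewrite br0 linear0 (anti u (D u)) addNr.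
have der12 : D (br e1 e2) = br (D e1) e2 + br e1 (D e2).
  rewrite D1 D2 linearZl_LR linearZr_LR /= h_br12 !(linearD, linearZ) /= D2 D3.
  apply: frame_eq; rewrite !(linearBl, linearDl, linearNl, linearZl_LR) /= !gram; lra.
have der13 : D (br e1 e3) = br (D e1) e3 + br e1 (D e3).
  rewrite D1 D3 linearZl_LR linearBr /= !linearZr_LR /= h_br12 h_br13.
  rewrite !(linearD, linearZ) /= D2 D3.
  apply: frame_eq; rewrite !(linearBl, linearDl, linearNl, linearZl_LR) /= !gram; lra.
have der23 : D (br e2 e3) = br (D e2) e3 + br e2 (D e3).
  rewrite D2 D3 linearZl_LR linearBr /= !linearZr_LR /= h_br23 !br_frame.
  by rewrite linear0 !scaler0 subr0 addr0.
apply: (derivation_of_basis basis_frame) => u v.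
by rewrite !inE => /or3P[]/eqP-> /or3P[]/eqP->; auto.
Qed.

End SymmetricForm.

(** * Solving the polynomial system *)

Lemma soliton_equations (F : realFieldType) (alpha beta gamma delta c : F) :
    alpha + delta != 0 -> alpha * gamma - beta * delta = 0 ->
    let A := beta * (beta - gamma) / 2 - alpha ^+ 2 in
    let B := delta * (beta - gamma) / 2 - alpha * gamma in
  [/\ beta * B = alpha * (A - c), beta * (2 * A - c) = 0,
      (delta - alpha) * B = - (c * gamma) & delta * (A - c) + beta * B = 0] ->
  [/\ alpha = 0, beta = 0, gamma = 0, c = 0 & delta <> 0] \/
  [/\ alpha <> 0, beta = 0 /\ gamma = 0, alpha ^+ 2 + c = 0
    & alpha + delta <> 0] \/
  [/\ alpha <> 0, beta <> 0, gamma = 0 /\ delta = 0,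
      beta ^+ 2 = 2 * alpha ^+ 2 & c = 0].
Proof.
move=> /eqP ad0 agbd A B [E1 E2 E3 E4].
have mul0 (x y : F) : x * y = 0 -> x = 0 \/ y = 0.
  by move/eqP; rewrite mulf_eq0 => /orP[]/eqP; [left|right].
have Ac : A - c = 0.
  (* Combining [E1] and [E4] gives [(alpha + delta) * (A - c) = 0]. *)
  have [//|//] : alpha + delta = 0 \/ A - c = 0 by apply: mul0; nra.
have bB : beta * B = 0 by rewrite E1 Ac mulr0.
have [b0|b0] := eqVneq beta 0.
  rewrite /A /B {}b0 in agbd Ac E3 *; have c_a2 : c = - alpha ^+ 2 by lra.
  have [a0|/eqP a0] := eqVneq alpha 0.
    rewrite {}a0 in ad0 c_a2 E3 *.
    have d0 : delta <> 0 by move=> d0; apply: ad0; lra.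
    left; split=> //; last by rewrite c_a2 expr0n oppr0.
    (* With [alpha = beta = 0] one has [B = - delta * gamma / 2] and [c = 0], so [E3] reads
       [delta * B = 0]. *)
    have /mul0[//|/mul0[]//] : delta * (delta * gamma) = 0.
    by rewrite c_a2 in E3; lra.
  have [//|g0] : alpha = 0 \/ gamma = 0 by apply: mul0; lra.
  by right; left; split=> //; lra.
have [/eqP|B0] := mul0 _ _ bB; first by rewrite (negPf b0).
have [/eqP|A2c] := mul0 _ _ E2; first by rewrite (negPf b0).
(* For nonzero [beta], both [A = c] and [2 * A = c] hold. *)
have c0 : c = 0 by lra.
have A0 : A = 0 by lra.
rewrite /A /B in A0 B0.
have a0 : alpha <> 0.
  move=> a0; have [/eqP|d0] : beta = 0 \/ delta = 0; last by apply: ad0; lra.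
    by apply: mul0; rewrite a0 in agbd; lra.
  by rewrite (negPf b0).
have g0 : gamma = 0.
  (* Substituting [beta * delta = alpha * gamma] into [2 * beta * B = 0] leaves
     [alpha * gamma * (beta + gamma) = 0]. The second alternative is then excluded: [gamma = - beta]
     would turn the constraint into [beta * (alpha + delta) = 0]. *)
  have [//|bg] : gamma = 0 \/ beta + gamma = 0.
    have [//|//] : alpha = 0 \/ gamma * (beta + gamma) = 0; last exact: mul0.
    apply: mul0.
    have : 2 * beta * (delta * (beta - gamma) / 2 - alpha * gamma) = 0.
      by rewrite B0 mulr0.
    have : (alpha * gamma - beta * delta) * (beta - gamma) = 0.
      by rewrite agbd mul0r.
    lra.
  have [/eqP|//] : beta = 0 \/ alpha + delta = 0.
    have g_b : gamma = - beta by lra.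
    by apply: mul0; rewrite g_b in agbd; lra.
  by rewrite (negPf b0).
have d0 : delta = 0.
  have [/eqP|//] : beta = 0 \/ delta = 0 by apply: mul0; rewrite g0 in agbd; lra.
  by rewrite (negPf b0).
right; right; split=> //; first exact/eqP.
by rewrite g0 in A0; lra.
Qed.

(** * Classification of the solitons and of their derivations *)

Theorem theorem3p13 (R : realType) (V : vectType R)
  (br : {bilinear V -> V -> V}) (g : {symmetric V}) (J : 'End(V))
  (nabla : {bilinear V -> V -> V}) (e1 e2 e3 : V)
  (alpha beta gamma delta c : R)
  (h_br : is_lie_bracket br)
  (h_basis : pseudo_orthonormal_basis g e1 e2 e3)
  (h_J : product_structure J e1 e2 e3)
  (h_nabla : is_levi_civita br g nabla)
  (h_br12 : br e1 e2 = alpha *: e2 + beta *: e3)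
  (h_br13 : br e1 e3 = gamma *: e2 + delta *: e3)
  (h_br23 : br e2 e3 = 0)
  (h_ad : alpha + delta != 0)
  (h_abcd : alpha * gamma - beta * delta = 0) :
  let nabla0 := canonical_connection nabla J in
  let case1 := [/\ alpha = 0, beta = 0, gamma = 0, c = 0 & delta <> 0] in
  let case2 := [/\ alpha <> 0, beta = 0 /\ gamma = 0, alpha ^+ 2 + c = 0
                 & alpha + delta <> 0] in
  let case3 := [/\ alpha <> 0, beta <> 0, gamma = 0 /\ delta = 0,
                   beta ^+ 2 = 2 * alpha ^+ 2 & c = 0] in
  (first_kind_soliton br g nabla0 e1 e2 e3 c <-> case1 \/ case2 \/ case3) /\
  (forall D : 'End(V), soliton_with_derivation br g nabla0 e1 e2 e3 c D ->
     [/\ case1 -> D = 0,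
         case2 -> [/\ D e1 = 0, D e2 = 0 & D e3 = alpha ^+ 2 *: e3] &
         case3 -> D = 0]).

Proof.
move=> nabla0 case1 case2 case3.
set A := beta * (beta - gamma) / 2 - alpha ^+ 2.
set B := delta * (beta - gamma) / 2 - alpha * gamma.
(* In every case [D] is therefore zero on [e1] and [e2] and sends [e3] to [- c *: e3]; this vanishes
   when [c = 0] and is [alpha ^+ 2 *: e3] in [case2]. *)
have AB : case1 \/ case2 \/ case3 -> A = c /\ B = 0.
  rewrite /A /B => -[[-> -> -> -> _]|[[_ [-> ->] ac _]|]].
  - by split; ring.
  - by split; lra.
  by move=> [_ _ [-> ->] b2 ->]; split; lra.
have solP D := soliton_with_derivationP h_basis h_J h_nabla c h_br h_br12
  h_br13 h_br23 D.
have derP := frame_derivationP h_basis h_br h_br12 h_br13 h_br23.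
split; first split=> [[D /solP[D1 D2 D3 /(derP _ _ D1 D2 D3)]]|cases].
- exact: soliton_equations.
(* The witness is the endomorphism with the frame values forced by the soliton equation. *)
- have [D [D1 D2 D3]] := End_frame_exists h_basis
    ((A - c) *: e1) ((A - c) *: e2) (B *: e2 - c *: e3).
  exists D; apply/solP; split=> //; apply/(derP _ _ D1 D2 D3).
  rewrite -/A -/B; have [-> ->] := AB cases; rewrite subrr !mulr0 addr0.
  case: cases => [[_ b0 g0 c0 _]|[[_ [b0 g0] _ _]|[_ _ [g0 _] _ c0]]];
  by rewrite ?b0 ?g0 ?c0; split; ring.
move=> D /solP[]; rewrite -/A -/B => D1 D2 D3 _; split=> cs.
- have [Ac B0] := AB (or_introl cs); have [_ _ _ c0 _] := cs.
  apply: (End_frame_eq h_basis); rewrite ?D1 ?D2 ?D3 lfunE /= ?Ac ?B0 ?c0;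
  by rewrite ?subrr !scale0r ?subr0.
- have [Ac B0] := AB (or_intror (or_introl cs)); have [_ _ ac _] := cs.
  rewrite D1 D2 D3 Ac B0 subrr !scale0r sub0r -scaleNr; split=> //.
  by congr (_ *: _); lra.
have [Ac B0] := AB (or_intror (or_intror cs)); have [_ _ _ _ c0] := cs.
apply: (End_frame_eq h_basis); rewrite ?D1 ?D2 ?D3 lfunE /= ?Ac ?B0 ?c0;
by rewrite ?subrr !scale0r ?subr0.
Qed.
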